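(* Let $w$ be a strictly positive density on $U$ of the form $w(\xi)=\sum_{j=1}^d\prod_{i=1}^n w_i^{(j)}(\xi_i)$, where $d\ge1$ and the $w_i^{(j)}$ are measurable functions of the single variable $\xi_i$ with $w_i^{(j)}\ge0$ for all $1\le i\le n$ and $1\le j\le d$. Then $w$ satisfies the Smirnov property, for every exponent $q>1$.
   Context: Let $n\ge 2$ and $U=I_1\times\dots\times I_n\subset\mathbb R^n$, where each $I_i$ is a closed interval of the form $(-\infty,b]$, $[a,\infty)$ or $[a,b]$ with $a<b$. A strictly positive density on $U$ is a Lebesgue-measurable $w:U\to(0,\infty)$ with $\int_U w(\xi)\,d\xi=1$. For $r\ge1$, $\mathcal L^r(w)$ is the space of (a.e.-equivalence classes of) Lebesgue-measurable $f:U\to\mathbb R$ with $\int_U|f(\xi)|^r w(\xi)\,d\xi<\infty$. A function of the single coordinate $\xi_i$ is regarded as a function on $U$. Smirnov property with exponent $q>1$: whenever $f(\xi)=\frac1n\sum_{i=1}^n\Psi_i(\xi_i)\in\mathcal L^q(w)$ with each $\Psi_i$ depending only on $\xi_i$ and $\Psi_i\in\mathcal L^1(w)$ for $1\le i\le n$, then $\Psi_i\in\mathcal L^q(w)$ for all $1\le i\le n$. *)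

(* Defs.v *)
From HB Require Import structures.
From mathcomp Require Import all_boot all_order all_algebra.
From mathcomp Require Import all_classical all_reals all_analysis.

Set Implicit Arguments.
Unset Strict Implicit.
Unset Printing Implicit Defensive.
Import Order.TTheory GRing.Theory Num.Theory.
Import numFieldNormedType.Exports.
Local Open Scope classical_set_scope.
Local Open Scope ring_scope.

(* A point of R^n is an n-tuple of reals, with its Borel (product)
   sigma-algebra. The Lebesgue measure on Borel sets of R^n is built by
   iterating the binary product along the bijection (x, t) |-> x :: t; see
   [borel_lebesgue_box] for the values on boxes. *)
Section borel_lebesgue.
Variable R : realType.
Local Notation RR := (measurableTypeR R).

Definition tcons n (p : (RR * n.-tuple RR)%type) : n.+1.-tuple RR :=
  [the n.+1.-tuple RR of p.1 :: p.2].

Lemma measurable_tcons n : measurable_fun setT (@tcons n).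
Proof. by apply: measurable_cons; [exact: measurable_fst|exact: measurable_snd]. Qed.

Definition tuncons n (t : n.+1.-tuple RR) : (RR * n.-tuple RR)%type :=
  (thead t, [tuple of behead t]).

Lemma tunconsK n : cancel (@tuncons n) (@tcons n).
Proof. by move=> t; rewrite /tcons /tuncons /= [RHS]tuple_eta; apply/val_inj. Qed.

Lemma tconsK n : cancel (@tcons n) (@tuncons n).
Proof.
move=> [x t]; rewrite /tcons /tuncons /thead tnth0; congr pair.
exact/val_inj.
Qed.

Lemma measurable_tuncons n : measurable_fun setT (@tuncons n).
Proof.
apply/measurable_fun_pairP; split.
- exact: (measurable_tnth (@ord0 n)).
- exact: measurable_behead.
Qed.

Section step.
Variables (n : nat) (mu : {sigma_finite_measure set (n.-tuple RR) -> \bar R}).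

Definition borel_lebesgue_step : set (n.+1.-tuple RR) -> \bar R :=
  pushforward (lebesgue_measure \x mu)%E (@tcons n).

Let step0 : borel_lebesgue_step set0 = 0%E.
Proof. by rewrite /borel_lebesgue_step /pushforward preimage_set0 measure0. Qed.

Let step_ge0 A : (0 <= borel_lebesgue_step A)%E.
Proof. by rewrite /borel_lebesgue_step /pushforward; exact: measure_ge0. Qed.

Let step_sigma_additive : semi_sigma_additive borel_lebesgue_step.
Proof.
have mtc A : measurable A -> measurable (@tcons n @^-1` A).
  by move=> mA; rewrite -[X in measurable X]setTI; exact: measurable_tcons.
move=> F mF tF mUF; rewrite /borel_lebesgue_step /pushforward preimage_bigcup.
apply: measure_semi_sigma_additive.
- by move=> k; exact: mtc.
- apply/trivIsetP => /= i j _ _ ij; rewrite -preimage_setI.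
  by move/trivIsetP : tF => /(_ _ _ _ _ ij) ->//; rewrite preimage_set0.
- by rewrite -preimage_bigcup; exact: mtc.
Qed.

HB.instance Definition _ := isMeasure.Build _ _ _
  borel_lebesgue_step step0 step_ge0 step_sigma_additive.

Let step_sigma_finite : sigma_finite setT borel_lebesgue_step.
Proof.
have /sigma_finiteP[F [TF ndF Foo]] :=
  sigma_finiteT (lebesgue_measure : {sigma_finite_measure set RR -> \bar R}).
have /sigma_finiteP[G [TG ndG Goo]] := sigma_finiteT mu.
exists (fun k => @tuncons n @^-1` (F k `*` G k)).
  rewrite -preimage_bigcup [X in _ @^-1` X](_ : _ = setT) ?preimage_setT//.
  apply/seteqP; split => // -[x t] _.
  have [k _ Fkx] : (\bigcup_k F k) x by rewrite -TF.
  have [l _ Glt] : (\bigcup_k G k) t by rewrite -TG.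
  exists (maxn k l) => //; split => /=.
    by move: Fkx; exact/subsetPset/ndF/leq_maxl.
  by move: Glt; exact/subsetPset/ndG/leq_maxr.
move=> k; have [mF Fk] := Foo k; have [mG Gk] := Goo k; split.
  rewrite -[X in measurable X]setTI.
  by apply: measurable_tuncons => //; exact: measurableX.
rewrite /borel_lebesgue_step /pushforward -comp_preimage.
rewrite (_ : _ \o _ = id); last by apply/funext => p; exact: tconsK.
by rewrite preimage_id product_measure1E// lte_mul_pinfty// ge0_fin_numE.
Qed.

HB.instance Definition _ := Measure_isSigmaFinite.Build _ _ _
  borel_lebesgue_step step_sigma_finite.
End step.

Fixpoint borel_lebesgue n : {sigma_finite_measure set (n.-tuple RR) -> \bar R} :=
  match n with
  | 0 => dirac [tuple]
  | m.+1 => borel_lebesgue_step (borel_lebesgue m)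
  end.

Lemma borel_lebesgue_box n (A : 'I_n -> set RR) :
  (forall i, measurable (A i)) ->
  borel_lebesgue n [set x | forall i, A i (tnth x i)] =
  (\prod_(i < n) lebesgue_measure (A i))%E.
Proof.
elim: n A => [|n IH] A mA.
  rewrite big_ord0 /= diracE mem_set//.
  by case.
rewrite big_ord_recl -IH//= -product_measure1E//.
  rewrite /borel_lebesgue_step /pushforward; congr product_measure1.
  apply/seteqP; split => [[x t] /= h|[x t] [/= Ax At] i].
    split; first by have := h ord0; rewrite tnth0.
    by move=> i; have := h (lift ord0 i); rewrite tnthS.
  by case: (unliftP ord0 i) => [j|] ->; rewrite ?tnthS ?tnth0.
rewrite (_ : [set x | _] = 
    \bigcap_(i in setT) ((fun x : n.-tuple RR => tnth x i) @^-1` A (lift ord0 i))).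
  apply: fin_bigcap_measurable => // i _; rewrite -[X in measurable X]setTI.
  exact: measurable_tnth.
by apply/seteqP; split => [x h i _|x h i]; [exact: h|exact: (h i)].
Qed.

End borel_lebesgue.

(* Lebesgue measurability on R^n is Caratheodory measurability for the outer
   measure of [borel_lebesgue n]; the restriction to these sets is complete.
   [lebesgue_line] is the same space for n = 1, without the tuple: it carries
   [completed_lebesgue_measure]. *)
Definition lebesgue_space (R : realType) (n : nat) :=
  caratheodory_type (borel_lebesgue R n)^*%mu.
HB.instance Definition _ (R : realType) (n : nat) :=
  Measurable.copy (lebesgue_space R n)
    (caratheodory_type (borel_lebesgue R n)^*%mu).

Definition lebesgue_line (R : realType) :=
  caratheodory_type (wlength (@idfun R))^*%mu.
HB.instance Definition _ (R : realType) :=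
  Measurable.copy (lebesgue_line R) (caratheodory_type (wlength (@idfun R))^*%mu).

Definition lebesgue (R : realType) (n : nat) :
    {measure set (lebesgue_space R n) -> \bar R} :=
  @completed_measure_extension _ _ _ (borel_lebesgue R n).

Lemma lebesgue_box (R : realType) (n : nat)
    (A : 'I_n -> set (measurableTypeR R)) :
  (forall i, measurable (A i)) ->
  lebesgue R n [set x | forall i, A i (tnth x i)] =
  (\prod_(i < n) lebesgue_measure (A i))%E.
Proof.
move=> mA; rewrite -borel_lebesgue_box//.
apply: measurable_mu_extE.
rewrite (_ : [set x | _] = \bigcap_(i in setT)
    ((fun x : n.-tuple (measurableTypeR R) => tnth x i) @^-1` A i)).
  apply: fin_bigcap_measurable => // i _; rewrite -[X in measurable X]setTI.
  exact: measurable_tnth.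
by apply/seteqP; split => [x h i _|x h i]; [exact: h|exact: (h i)].
Qed.

Section smirnov.
Variables (R : realType) (n : nat).

(* The whole line is not among the admissible intervals. *)
Definition admissible_itv (J : interval R) : Prop :=
  [\/ exists b, J = `]-oo, b], exists a, J = `[a, +oo[
    | exists a b, a < b /\ J = `[a, b]].

Definition box (I : 'I_n -> interval R) : set (lebesgue_space R n) :=
  [set x | forall i, tnth x i \in I i].

Variables (U : set (lebesgue_space R n)) (w : lebesgue_space R n -> R).

Definition strictly_positive_density : Prop :=
  [/\ measurable_fun U w,
      (forall x, U x -> 0 < w x) &
      (\int[lebesgue R n]_(x in U) (w x)%:E = 1)%E].

(* Functions on U are total functions whose values outside of U are
   irrelevant; [weighted_L] is invariant under a.e. equality on U. *)
Definition weighted_L (r : R) (f : lebesgue_space R n -> R) : Prop :=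
  measurable_fun U f /\
  (\int[lebesgue R n]_(x in U) (`|f x| `^ r * w x)%:E < +oo)%E.

Definition coord_fun (i : 'I_n) (g : R -> R) (x : lebesgue_space R n) : R :=
  g (tnth x i).

(* Elements of the spaces L^q(w) are a.e.-equivalence classes, hence the
   equality between f and the average holds almost everywhere on U. *)
Definition smirnov (q : R) : Prop :=
  forall (f : lebesgue_space R n -> R) (Psi : 'I_n -> R -> R),
    {ae lebesgue R n, forall x, U x ->
       f x = n%:R^-1 * \sum_(i < n) coord_fun i (Psi i) x} ->
    weighted_L q f ->
    (forall i, weighted_L 1 (coord_fun i (Psi i))) ->
    forall i, weighted_L q (coord_fun i (Psi i)).

End smirnov.

(* Main.v *)
Require Import Defs.
From HB Require Import structures.
From mathcomp Require Import all_boot all_order all_algebra.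
From mathcomp Require Import all_classical all_reals all_analysis.
From mathcomp Require Import measurable_realfun.

(* Fix one product density W = prod_k W_k below w. By Tonelli, almost every
   choice of the coordinates other than xi_i turns n f into Psi_i + c, with c a
   constant, and leaves a function of xi_i whose q-th power is integrable
   against W_i. One such choice suffices: as W_i has finite mass, Psi_i itself
   is then in L^q(W_i), hence in L^q(W); summing over the d products gives
   L^q(w).
   Tonelli is applied to Borel functions that coincide with the Lebesgue
   measurable ones, or dominate them, almost everywhere. *)

Set Implicit Arguments.
Unset Strict Implicit.
Unset Printing Implicit Defensive.
Import Order.TTheory GRing.Theory Num.Theory.
Import numFieldNormedType.Exports.
Local Open Scope classical_set_scope.
Local Open Scope ring_scope.

(** * Measurable sets and the completion of a sigma-finite measure *)

Section completion.
Local Open Scope ereal_scope.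
Context d (T : measurableType d) (R : realType).
Variable mu : {sigma_finite_measure set T -> \bar R}.
Local Notation cT := (caratheodory_type (mu^*)%mu).
Local Notation cmu := (@completed_measure_extension _ _ _ mu).

Lemma caratheodory_borel (A : set T) :
  measurable A -> measurable (A : set cT).
Proof. exact: caratheodory_measurable_mu_ext. Qed.

(** Countable covers of [X] by measurable sets come within [1/(n+1)] of its outer measure;
    intersecting one such cover for each [n] attains it. When the outer measure is infinite, [setT]
    serves. *)
Lemma measurable_hull (X : set T) :
  exists B, [/\ measurable B, X `<=` B & mu B = (mu^*)%mu X].
Proof.
have [Xoo|Xfin] := eqVneq ((mu^*)%mu X) +oo.
  exists setT; split => //; apply/eqP; rewrite Xoo -leye_eq -Xoo.
  by rewrite -(measurable_mu_extE mu measurableT); exact: le_mu_ext.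
have fX : (mu^*)%mu X \is a fin_num.
  by rewrite ge0_fin_numE ?ltey//; exact: mu_ext_ge0.
have hB (n : nat) : exists B, [/\ measurable B, X `<=` B &
    mu B <= (mu^*)%mu X + n.+1%:R^-1%:E].
  have n0 : (0 < n.+1%:R^-1 :> R)%R by rewrite invr_gt0.
  have [_ [A [mA XA] <-] hA] := lb_ereal_inf_adherent n0 fX.
  exists (\bigcup_k A k); split => //; first exact: bigcupT_measurable.
  apply: le_trans (ltW hA); apply: measure_sigma_subadditive => //.
  exact: bigcupT_measurable.
have [B hB'] := choice hB.
exists (\bigcap_n B n); split.
- by apply: bigcapT_measurable => n; case: (hB' n).
- by move=> x Xx n _; case: (hB' n) => _ + _; exact.
have mB : measurable (\bigcap_n B n).
  by apply: bigcapT_measurable => n; case: (hB' n).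
apply/eqP; rewrite eq_le; apply/andP; split; last first.
  rewrite -(measurable_mu_extE mu mB); apply: le_mu_ext => x Xx n _.
  by case: (hB' n) => _ + _; exact.
apply/lee_addgt0Pr => /= e e0; near \oo => n.
have [mBn _ le] := hB' n.
apply: (@le_trans _ _ (mu (B n))).
  by apply: le_measure; rewrite ?inE//; exact: bigcap_inf.
rewrite (le_trans le)// leeD2l// lee_fin ltW//.
by near: n; exact: near_infty_natSinv_lt (PosNum e0).
Unshelve. all: by end_near. Qed.

Lemma negligible_completion (N : set cT) : cmu.-negligible N ->
  exists B : set T, [/\ measurable B, mu B = 0 & N `<=` B].
Proof.
move=> [A [mA A0 NA]]; have [B [mB AB muB]] := measurable_hull A.
by exists B; split => //; [rewrite muB | exact: subset_trans AB].
Qed.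

(** If [E] has finite measure, let [B] be a hull of [E] and [N] a hull of the difference of [B] and
    [E], which is null by subtraction of finite measures; then [B] minus [N] serves as [A]. In
    general [E] is cut into countably many pieces of finite measure. *)
Lemma caratheodory_decomp (E : set cT) : measurable E ->
  exists A N : set T, [/\ measurable A, measurable N, mu N = 0,
    A `<=` E & E `<=` A `|` N].
Proof.
have fin (E' : set cT) : measurable E' -> cmu E' < +oo ->
    exists A N : set T, [/\ measurable A, measurable N, mu N = 0,
    A `<=` E' & E' `<=` A `|` N].
  move=> mE Eoo; have [B [mB EB muB]] := measurable_hull E'.
  have BE0 : cmu (B `\` E') = 0.
    have cB : cmu B = cmu E' by rewrite /= -[RHS]muB; exact: measurable_mu_extE.
    have mcB : measurable (B : set cT) by exact: caratheodory_borel.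
    rewrite measureD//; last by move: Eoo; rewrite -cB.
    by rewrite setIidr// [X in X - _](_ : _ = cmu E')// subee// ge0_fin_numE.
  have [N [mN BEN muN]] := measurable_hull (B `\` E').
  exists (B `\` N), N; split => //.
  - exact: measurableD.
  - by rewrite muN.
  - by move=> x [Bx Nx]; apply: contrapT => Ex; apply: Nx; exact: BEN.
  - move=> x Ex; have [Nx|Nx] := pselect (N x); [by right|left; split => //].
    exact: EB.
move=> mE.
have [F TF mF] := sigma_finiteT mu.
have h k : exists p : set T * set T, [/\ measurable p.1, measurable p.2,
    mu p.2 = 0, p.1 `<=` E `&` F k & E `&` F k `<=` p.1 `|` p.2].
  have [mFk Fkoo] := mF k.
  have mcF : measurable (F k : set cT) by exact: caratheodory_borel.
  have mEF : measurable (E `&` F k : set cT) by exact: measurableI.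
  have [|A [N [? ? ? ? ?]]] := fin _ mEF; last by exists (A, N).
  apply: le_lt_trans Fkoo.
  apply: (le_trans (le_mu_ext mu (@subIsetr _ E (F k)))).
  by rewrite measurable_mu_extE.
have [p hp] := choice h.
exists (\bigcup_k (p k).1), (\bigcup_k (p k).2); split.
- by apply: bigcupT_measurable => k; case: (hp k).
- by apply: bigcupT_measurable => k; case: (hp k).
- apply/negligibleP; first by apply: bigcupT_measurable => k; case: (hp k).
  apply: negligible_bigcup => k; have [_ mN N0 _ _] := hp k.
  exact/negligibleP.
- by move=> x [k _ Ax]; have [_ _ _ /(_ _ Ax)[]] := hp k.
- move=> x Ex; have [k _ Fkx] : (\bigcup_k F k) x by rewrite -TF.
  have [_ _ _ _ /(_ x (conj Ex Fkx))[?|?]] := hp k; first by left; exists k.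
  by right; exists k.
Qed.

Lemma integral_completion (D : set T) (f : T -> \bar R) :
  measurable D -> measurable_fun D f -> (forall x, D x -> 0 <= f x) ->
  \int[cmu]_(x in D) f x = \int[mu]_(x in D) f x.
Proof.
move=> mD mf f0.
have mid : measurable_fun setT (id : cT -> T).
  by move=> _ A mA; rewrite setTI; exact: caratheodory_borel.
(* The identity pushes the completed measure forward to a measure that agrees with [mu] on the
   measurable sets of [T]. *)
transitivity (\int[pushforward cmu (id : cT -> T)]_(x in D) f x).
  by rewrite (ge0_integral_pushforward mid)// => x; rewrite inE; exact: f0.
by apply: eq_measure_integral => A mA _; exact: measurable_mu_extE.
Qed.

End completion.

(** * Borel versions and majorants of functions measurable for the completion *)

Lemma ae_borel_measurable_fun d (T : measurableType d) (R : realType)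
    (mu : {measure set T -> \bar R}) (D : set T) (f : T -> R) : measurable D ->
  (forall B, measurable B -> exists A N : set T, [/\ measurable A,
    measurable N, mu N = 0%E, A `<=` D `&` f @^-1` B &
    D `&` f @^-1` B `<=` A `|` N]) ->
  exists N, [/\ measurable N, mu N = 0%E & measurable_fun (D `\` N) f].
Proof.
move=> mD h.
(* Only the rays above rational thresholds are approximated: there are countably many, so their
   exceptional sets have a null union. Numbers that code no rational give the threshold 0, which is
   harmless. *)
pose q (k : nat) : R := ratr (odflt 0%Q (unpickle k)).
have qK (a : rat) : q (pickle a) = ratr a by rewrite /q pickleK.
have /choice[p hp] (k : nat) : exists p : set T * set T, [/\ measurable p.1,
    measurable p.2, mu p.2 = 0%E, p.1 `<=` D `&` f @^-1` `]q k, +oo[ &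
    D `&` f @^-1` `]q k, +oo[ `<=` p.1 `|` p.2].
  have [|A [N ?]] := h (`]q k, +oo[%classic); last by exists (A, N).
  exact: measurable_itv.
pose N := \bigcup_k (p k).2.
have mN : measurable N by apply: bigcupT_measurable => k; case: (hp k).
exists N; split => //.
  apply/negligibleP => //; apply: negligible_bigcup => k.
  by have [_ mpN N0 _ _] := hp k; exact/negligibleP.
apply: (measurability _ (RGenOInfty.measurableE R)) => _ [_ [r ->] <-].
(* Off [N] the preimage of each rational ray is its measurable part, and the ray above [r] is the
   union of the rays above the rationals that are at least [r]. *)
rewrite (_ : _ `&` _ = (\bigcup_(k in [set k | r <= q k]) (p k).1) `\` N).
  apply: measurableD => //; apply: bigcup_measurable => k _.
  by case: (hp k).
apply/seteqP; split => [x [[Dx Nx]]|x [[k /= rq Ax] Nx]].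
  rewrite /= in_itv/= andbT => rf; split => //.
  have [a] := rat_in_itvoo rf; rewrite in_itv/= => /andP[ra af].
  exists (pickle a); first by rewrite /mkset qK ltW.
  have [_ _ _ _ /(_ x)] := hp (pickle a).
  case=> //; first by split=> //; rewrite qK/= in_itv/= af.
  by move=> Nax; case: Nx; exists (pickle a).
have [_ _ _ /(_ _ Ax)[Dx] + _] := hp k.
rewrite /= !in_itv/= !andbT => qf; split; first by split.
exact: le_lt_trans qf.
Qed.

Section majorant.
Local Open Scope ereal_scope.
Context d (T : measurableType d) (R : realType).
Variable mu : {sigma_finite_measure set T -> \bar R}.
Local Notation cT := (caratheodory_type (mu^*)%mu).
Local Notation cmu := (@completed_measure_extension _ _ _ mu).

Lemma caratheodory_ae_borel (D : set T) (f : T -> R) : measurable D ->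
  measurable_fun (D : set cT) (f : cT -> R) ->
  exists N, [/\ measurable N, mu N = 0 & measurable_fun (D `\` N) f].
Proof.
move=> mD mf; apply: (@ae_borel_measurable_fun _ _ _ mu) => // B mB.
by apply: caratheodory_decomp; apply: mf => //; exact: caratheodory_borel.
Qed.

(* The value [+oo] of [G] marks the exceptional null set. *)
Lemma borel_majorant (D : set T) (g : T -> R) (P : T -> Prop) :
  measurable D -> measurable_fun (D : set cT) (g : cT -> R) ->
  (forall x, D x -> (0 <= g x)%R) ->
  \int[cmu]_(x in D) (g x)%:E < +oo -> {ae cmu, forall x, P x} ->
  exists G : T -> \bar R, [/\ measurable_fun setT G, forall x, 0 <= G x,
    \int[mu]_x G x < +oo, forall x, D x -> (g x)%:E <= G x &
    forall x, ~ P x -> G x = +oo].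
Proof.
move=> mD mg g0 goo aeP.
have [N1 [mN1 N10 mg1]] := caratheodory_ae_borel mD mg.
have [N2 [mN2 N20 PN2]] := negligible_completion aeP.
(* On [D], [g] is Borel off [N1]; the points where [P] fails lie in [N2]. *)
pose N := N1 `|` N2.
have mN : measurable N by exact: measurableU.
have N0 : mu N = 0.
  by apply/negligibleP => //; apply: negligibleU; exact/negligibleP.
have mDN : measurable (D `\` N) by exact: measurableD.
have mgN : measurable_fun (D `\` N) g.
  apply: measurable_funS mg1; first exact: measurableD.
  by move=> x [Dx Nx]; split => // N1x; apply: Nx; left.
pose G1 := (EFin \o g) \_ (D `\` N).
(* As [+oo * 0 = 0], this is [+oo] on [N] and 0 elsewhere, with integral zero. *)
pose G2 x : \bar R := +oo * (\1_N x)%:E.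
have mG1 : measurable_fun setT G1.
  by apply/(measurable_restrictT (EFin \o g) mDN)/measurable_EFinP.
have mi : measurable_fun setT (fun x => (\1_N x)%:E : \bar R).
  by apply/measurable_EFinP.
have mG2 : measurable_fun setT G2 by exact: measurable_funeM.
have G10 x : 0 <= G1 x.
  rewrite /G1 patchE; case: ifPn => // /set_mem[Dx _].
  by rewrite lee_fin g0.
have G20 x : 0 <= G2 x by rewrite /G2 mule_ge0// lee_fin.
have iG2 : \int[mu]_x G2 x = 0.
  by rewrite ge0_integralZl// integral_indic// setIT [X in _ * X](_ : _ = 0) ?mule0.
exists (fun x => G1 x + G2 x); split.
- exact: emeasurable_funD.
- by move=> x; exact: adde_ge0.
- rewrite ge0_integralD// iG2 adde0 /G1 -integral_mkcond.
  rewrite -(integral_completion mu mDN); last 2 first.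
  + exact/measurable_EFinP.
  + by move=> x [Dx _]; rewrite lee_fin g0.
  apply: le_lt_trans goo; apply: ge0_subset_integral => //.
  + exact: caratheodory_borel.
  + exact: caratheodory_borel.
  + exact/measurable_EFinP.
- move=> x Dx; have [Nx|Nx] := pselect (N x).
    rewrite /G2 indicE mem_set// mule1 addey ?leey//.
    by rewrite gt_eqF// (lt_le_trans _ (G10 x)).
  rewrite /G1 patchE mem_set//= leeDl//.
- move=> x nPx; have Nx : N x by right; exact: PN2.
  rewrite /G2 indicE mem_set// mule1 addey//.
  by rewrite gt_eqF// (lt_le_trans _ (G10 x)).
Qed.

End majorant.

(** [F] is finite almost everywhere, so if [V] vanished wherever [F] is finite, its integral would
    be zero. With [V] a weight and [F] the integral over a slice, this selects the one slice on
    which the argument runs. *)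
Lemma exists_pos_lty d (T : measurableType d) (R : realType)
    (mu : {measure set T -> \bar R}) (F : T -> \bar R) (V : T -> \bar R) :
  measurable_fun setT F -> (forall x, 0 <= F x)%E ->
  (\int[mu]_x F x < +oo)%E ->
  measurable_fun setT V -> (forall x, 0 <= V x)%E ->
  (\int[mu]_x V x != 0)%E ->
  exists x, (0 < V x)%E /\ (F x < +oo)%E.
Proof.
move=> mF F0 Foo mV V0; apply: contra_neqP => /forallNP h.
have iF : mu.-integrable setT F.
  apply/integrableP; split => //.
  by under eq_integral do rewrite gee0_abs//.
have [N [mN N0 FN]] := integrable_ae measurableT iF.
rewrite -(integral0 mu setT).
apply: ge0_ae_eq_integral => //.
exists N; split => // x /= Vx; apply: FN => /= Fx.
apply: Vx => _; apply/eqP; rewrite eq_le V0 andbT leNgt; apply/negP => Vx0.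
by apply: (h x); split => //; rewrite -ge0_fin_numE//; exact: Fx.
Qed.

Lemma emeasurable_prod d (T : measurableType d) (R : realType) (I : Type)
    (s : seq I) (h : I -> T -> \bar R) :
  (forall i, measurable_fun setT (h i)) ->
  measurable_fun setT (fun x => \prod_(i <- s) h i x)%E.
Proof.
move=> mh; elim: s => [|i s IH].
  by under eq_fun do rewrite big_nil; exact: measurable_cst.
under eq_fun do rewrite big_cons; exact: emeasurable_funM.
Qed.

(** * Tonelli's theorem for the splitting of a tuple into head and tail *)

Section tonelli.
Local Open Scope ereal_scope.
Variable R : realType.
Local Notation RR := (measurableTypeR R).
Local Notation leb := (@lebesgue_measure R).

Lemma tnth_tcons0 n (t : RR) (y : n.-tuple RR) : tnth (tcons (t, y)) ord0 = t.
Proof. by rewrite tnth0. Qed.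

Lemma tnth_tconsS n (t : RR) (y : n.-tuple RR) k :
  tnth (tcons (t, y)) (lift ord0 k) = tnth y k.
Proof. by rewrite tnthS. Qed.

Section fubini.
Variables (n : nat) (f : n.+1.-tuple RR -> \bar R).
Hypotheses (mf : measurable_fun setT f) (f0 : forall x, 0 <= f x).

Let mft : measurable_fun setT (f \o @tcons R n).
Proof. exact: (measurableT_comp mf (@measurable_tcons R n)). Qed.

Let ft0 p : 0 <= (f \o @tcons R n) p.
Proof. exact: f0. Qed.

Let integral_tcons : \int[borel_lebesgue R n.+1]_x f x =
  \int[leb \x borel_lebesgue R n]_p (f \o @tcons R n) p.
Proof.
exact: (ge0_integral_pushforward (@measurable_tcons R n)
  (leb \x borel_lebesgue R n) measurableT mf (fun y _ => f0 y)).
Qed.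

Lemma measurable_integral_head :
  measurable_fun setT (fun y => \int[leb]_t f (tcons (t, y))).
Proof. exact: (measurable_fun_fubini_tonelli_G (m1 := leb) _ mft ft0). Qed.

Lemma measurable_integral_tail :
  measurable_fun setT (fun t => \int[borel_lebesgue R n]_y f (tcons (t, y))).
Proof. exact: (measurable_fun_fubini_tonelli_F (m2 := borel_lebesgue R n) _ mft ft0). Qed.

Lemma integral_head_tail : \int[borel_lebesgue R n.+1]_x f x =
  \int[leb]_t \int[borel_lebesgue R n]_y f (tcons (t, y)).
Proof.
by rewrite integral_tcons
  (fubini_tonelli1 (m1 := leb) (m2 := borel_lebesgue R n) _ mft ft0).
Qed.

Lemma integral_tail_head : \int[borel_lebesgue R n.+1]_x f x =
  \int[borel_lebesgue R n]_y \int[leb]_t f (tcons (t, y)).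
Proof.
by rewrite integral_tcons
  (fubini_tonelli2 (m1 := leb) (m2 := borel_lebesgue R n) _ mft ft0).
Qed.

End fubini.

Lemma measurable_coord_prod n (h : 'I_n -> RR -> \bar R) :
  (forall k, measurable_fun setT (h k)) ->
  measurable_fun setT (fun x : n.-tuple RR => \prod_(k < n) h k (tnth x k)).
Proof.
move=> mh; apply: emeasurable_prod => k.
exact: (measurableT_comp (mh k) (measurable_tnth k)).
Qed.

(** Tonelli separates the head, and nonnegative constants, even infinite ones, leave the inner and
    then the outer integral. For [n = 0] the measure is the Dirac mass at the empty tuple. *)
Lemma integral_coord_prod n (h : 'I_n -> RR -> \bar R) :
  (forall k, measurable_fun setT (h k)) -> (forall k t, 0 <= h k t) ->
  \int[borel_lebesgue R n]_x \prod_(k < n) h k (tnth x k) =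
  \prod_(k < n) \int[leb]_t h k t.
Proof.
elim: n h => [|n IH] h mh h0.
  under eq_integral do rewrite big_ord0.
  by rewrite big_ord0 integral_dirac// diracT mul1e.
have p0 m (g : 'I_m -> RR -> \bar R) (x : m.-tuple RR) :
    (forall k t, 0 <= g k t) -> 0 <= \prod_(k < m) g k (tnth x k).
  by move=> g0; apply: prode_ge0.
rewrite integral_head_tail; last 2 first.
- exact: measurable_coord_prod.
- by move=> x; exact: p0.
under eq_integral => t _.
  under eq_integral => y _.
    rewrite big_ord_recl tnth_tcons0.
    under eq_bigr do rewrite tnth_tconsS.
    over.
  rewrite ge0_integralZl//=; last 2 first.
  - by apply: (measurable_coord_prod (h := fun k => h (lift ord0 k))).
  - by move=> y _; apply: (p0 _ (fun k => h (lift ord0 k))).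
  rewrite (IH (fun k => h (lift ord0 k)))// muleC.
  over.
rewrite ge0_integralZl//; last by apply: prode_ge0 => k _; exact: integral_ge0.
by rewrite big_ord_recl muleC.
Qed.

End tonelli.

(** * Majorants for a single product density *)

Lemma normr_powR_shift (R : realType) (q a c : R) : 0 <= q ->
  `|a| `^ q <= 2 `^ q * (`|a + c| `^ q + `|c| `^ q).
Proof.
(* [|a|] is at most [2 * m], and the power of [m] is one of the two summands; no convexity is used,
   so every [q >= 0] is covered. *)
move=> q0; pose m := Num.max `|a + c| `|c|.
have m0 : 0 <= m by rewrite le_max normr_ge0.
have am : `|a| <= 2 * m.
  rewrite -[in `|a|](addrK c a) (le_trans (ler_normB _ _))// mulr_natl mulr2n.
  by rewrite lerD// /m le_max lexx ?orbT.
apply: (@le_trans _ _ ((2 * m) `^ q)).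
  by apply: ge0_ler_powR; rewrite ?nnegrE// mulr_ge0.
rewrite powRM// ler_wpM2l ?powR_ge0// /m.
by case: (leP `|a + c| `|c|) => _; rewrite ?lerDl ?lerDr powR_ge0.
Qed.

Lemma prode_gt0 (R : realDomainType) (I : Type) (s : seq I) (f : I -> \bar R) :
  (forall i, 0 < f i)%E -> (0 < \prod_(i <- s) f i)%E.
Proof.
by move=> f0; elim/big_rec: _ => [|i x _ x0]; rewrite ?lte01// mule_gt0.
Qed.

(* The last hypothesis holds everywhere, not just almost everywhere: [G] is
   [+oo] on the exceptional set. *)
Lemma coordinate_majorant (R : realType) (q : R) (n : nat)
    (W : 'I_n -> measurableTypeR R -> R) (Psi : 'I_n -> R -> R) (c : R)
    (G : n.-tuple (measurableTypeR R) -> \bar R) :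
  0 <= q ->
  (forall k, measurable_fun setT (W k)) -> (forall k t, 0 <= W k t) ->
  (forall k, 0 < \int[lebesgue_measure]_t (W k t)%:E < +oo)%E ->
  measurable_fun setT G -> (forall x, 0 <= G x)%E ->
  (\int[borel_lebesgue R n]_x G x < +oo)%E ->
  (forall x, (`|\sum_(k < n) Psi k (tnth x k) + c| `^ q *
    \prod_(k < n) W k (tnth x k))%:E <= G x)%E ->
  forall i, exists H : measurableTypeR R -> \bar R,
    [/\ measurable_fun setT H, (forall t, 0 <= H t)%E,
      (\int[lebesgue_measure]_t H t < +oo)%E &
      forall t, ((`|Psi i t| `^ q * W i t)%:E <= H t)%E].
Proof.
(* The constant [c] varies in the induction: it collects the values of [Psi] at the coordinates
   already fixed. *)
move=> q0; elim: n W Psi c G => [|n IH] W Psi c G mW W0 iW mG G0 Goo GW i.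
  by case: i.
pose W' k := W (lift ord0 k); pose Psi' k := Psi (lift ord0 k).
have sumE t y : \sum_(k < n.+1) Psi k (tnth (tcons (t, y)) k) =
    Psi ord0 t + \sum_(k < n) Psi' k (tnth y k).
  rewrite big_ord_recl tnth_tcons0; congr (_ + _).
  by apply: eq_bigr => k _; rewrite tnth_tconsS.
have prodE t y : \prod_(k < n.+1) W k (tnth (tcons (t, y)) k) =
    W ord0 t * \prod_(k < n) W' k (tnth y k).
  rewrite big_ord_recl tnth_tcons0; congr (_ * _).
  by apply: eq_bigr => k _; rewrite tnth_tconsS.
have mW0 : measurable_fun setT (EFin \o W ord0) by exact/measurable_EFinP.
case: (unliftP ord0 i) => [k|] ->{i}.
(* Coordinate [i] lies in the tail. The head is fixed at a [t] where [W ord0 t] is positive and the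
   slice of [G] is integrable; the induction hypothesis applies with [Psi ord0 t] added to the
   constant and the slice divided by [W ord0 t]. *)
- have [||||||t [Wt Gt]] := @exists_pos_lty _ _ _ (@lebesgue_measure R)
      (fun t => \int[borel_lebesgue R n]_y G (tcons (t, y)))%E
      (EFin \o W ord0).
  + exact: measurable_integral_tail.
  + by move=> t; apply: integral_ge0.
  + by rewrite -integral_head_tail.
  + exact: mW0.
  + by move=> t; rewrite /= lee_fin.
  + by rewrite gt_eqF//; case/andP: (iW ord0).
  rewrite /= lte_fin in Wt.
  have mGt : measurable_fun setT (fun y => G (tcons (t, y))).
    apply: (measurableT_comp mG); apply: (measurableT_comp (@measurable_tcons R n)).
    exact: measurable_pair1.
  apply: (IH W' Psi' (Psi ord0 t + c)
      (fun y => (W ord0 t)^-1%:E * G (tcons (t, y)))%E).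
  + by move=> j; exact: mW.
  + by move=> j u; exact: W0.
  + by move=> j; exact: iW.
  + exact: measurable_funeM.
  + by move=> y; rewrite mule_ge0// lee_fin invr_ge0 W0.
  + rewrite ge0_integralZl//; last by rewrite lee_fin invr_ge0 W0.
    by rewrite lte_mul_pinfty// lee_fin invr_ge0 W0.
  + move=> y; have := GW (tcons (t, y)); rewrite sumE prodE => h.
    have W0i : (0 <= (W ord0 t)^-1%:E)%E by rewrite lee_fin invr_ge0 W0.
    apply: le_trans (lee_wpmul2l W0i h); rewrite -EFinM lee_fin.
    rewrite [X in _ <= _ * X]mulrCA mulKf ?lt0r_neq0//.
    by rewrite [in leLHS]addrCA addrA.
(* Coordinate [i] is the head. All the others are fixed at once, at a [y] where their product weight
   is positive and the slice of [G] is integrable in [t]. *)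
- pose V y := (\prod_(k < n) (EFin \o W' k) (tnth y k))%E.
  have mV : measurable_fun setT V.
    by apply: (measurable_coord_prod (h := fun k => EFin \o W' k)) => k;
      apply/measurable_EFinP; exact: mW.
  have V0 y : (0 <= V y)%E.
    by apply: prode_ge0 => k _; rewrite /= lee_fin; exact: W0.
  have [||||||y [Vy Gy]] := @exists_pos_lty _ _ _ (borel_lebesgue R n)
      (fun y => \int[lebesgue_measure]_t G (tcons (t, y)))%E V.
  + exact: measurable_integral_head.
  + by move=> y; apply: integral_ge0.
  + by rewrite -integral_tail_head.
  + exact: mV.
  + exact: V0.
  + rewrite /V (integral_coord_prod (h := fun k => EFin \o W' k)).
    * rewrite gt_eqF// prode_gt0// => k.
      by case/andP: (iW (lift ord0 k)).
    * by move=> k; apply/measurable_EFinP; exact: mW.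
    * by move=> k t; rewrite /= lee_fin; exact: W0.
  pose P := \prod_(k < n) W' k (tnth y k).
  have P0 : 0 < P by rewrite -lte_fin /P -prodEFin.
  have Pi0 : (0 <= P^-1%:E)%E by rewrite lee_fin invr_ge0 ltW.
  pose c' := \sum_(k < n) Psi' k (tnth y k) + c.
  have mGy : measurable_fun setT (fun t => G (tcons (t, y))).
    apply: (measurableT_comp mG); apply: (measurableT_comp (@measurable_tcons R n)).
    exact: measurable_pair2.
  (* These are the two terms of [normr_powR_shift]: the shifted one is controlled by the slice of
     [G] divided by the weight [P], the constant one is integrable because [W ord0] has finite
     mass. *)
  pose H1 t : \bar R := ((2 `^ q)%:E * (P^-1%:E * G (tcons (t, y))))%E.
  pose H2 t : \bar R := ((2 `^ q * `|c'| `^ q)%:E * (W ord0 t)%:E)%E.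
  have mH1 : measurable_fun setT H1.
    by apply: measurable_funeM; exact: measurable_funeM.
  have mH2 : measurable_fun setT H2 by exact: measurable_funeM.
  have q2 : (0 <= (2 `^ q)%:E :> \bar R)%E by rewrite lee_fin powR_ge0.
  have qc : (0 <= (2 `^ q * `|c'| `^ q)%:E)%E.
    by rewrite lee_fin mulr_ge0// powR_ge0.
  have H10 t : (0 <= H1 t)%E by rewrite !mule_ge0.
  have H20 t : (0 <= H2 t)%E by rewrite mule_ge0// lee_fin.
  exists (fun t => H1 t + H2 t)%E; split.
  + exact: emeasurable_funD.
  + by move=> t; exact: adde_ge0.
  + rewrite ge0_integralD// lte_add_pinfty//.
    * rewrite ge0_integralZl//; last 2 first.
        exact: measurable_funeM.
        by move=> t _; rewrite mule_ge0.
      by rewrite ge0_integralZl// !lte_mul_pinfty// mule_ge0// integral_ge0.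
    * rewrite ge0_integralZl//; last by move=> t _; rewrite lee_fin.
      rewrite lte_mul_pinfty//; first by case/andP: (iW ord0).
  + move=> t; have := GW (tcons (t, y)); rewrite sumE prodE -/P -addrA -/c' => h.
    have h' : ((`|Psi ord0 t + c'| `^ q * W ord0 t)%:E <=
        P^-1%:E * G (tcons (t, y)))%E.
      apply: le_trans (lee_wpmul2l Pi0 h); rewrite -EFinM lee_fin.
      by rewrite mulrA mulrCA mulVf ?mulr1// lt0r_neq0.
    apply: le_trans (leeD2r _ (lee_wpmul2l q2 h')).
    rewrite /H2 -!EFinM -EFinD lee_fin mulrA -mulrDl -mulrDr.
    by rewrite ler_wpM2r// normr_powR_shift.
Qed.

(** As the product is nonzero, an infinite factor would make it infinite. Applied to masses, this
    passes from a product density to each [W k]. *)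
Lemma prode_lty_factor (R : realDomainType) (n : nat) (f : 'I_n -> \bar R) :
  (forall k, 0 <= f k)%E -> (\prod_(k < n) f k != 0)%E ->
  (\prod_(k < n) f k < +oo)%E -> forall k, (0 < f k < +oo)%E.
Proof.
move=> f0 + + k; rewrite (bigD1 k)//= mule_eq0 negb_or => /andP[fk r0] foo.
rewrite lt0e fk f0/= ltey; apply: contraTneq foo => ->.
by rewrite gt0_mulye ?ltxx// lt0e r0 prode_ge0.
Qed.

(** The one-variable majorant from [coordinate_majorant], multiplied by the remaining factors [W k],
    has as integral a product of finite integrals. The positive finite masses required there are
    available unless the product of the masses vanishes. *)
Lemma term_majorant (R : realType) (q : R) (n : nat)
    (W : 'I_n -> measurableTypeR R -> R) (Psi : 'I_n -> R -> R)
    (G : n.-tuple (measurableTypeR R) -> \bar R) :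
  0 <= q ->
  (forall k, measurable_fun setT (W k)) -> (forall k t, 0 <= W k t) ->
  (\int[borel_lebesgue R n]_x (\prod_(k < n) W k (tnth x k))%:E < +oo)%E ->
  measurable_fun setT G -> (forall x, 0 <= G x)%E ->
  (\int[borel_lebesgue R n]_x G x < +oo)%E ->
  (forall x, (`|\sum_(k < n) Psi k (tnth x k)| `^ q *
    \prod_(k < n) W k (tnth x k))%:E <= G x)%E ->
  forall i, exists K : n.-tuple (measurableTypeR R) -> \bar R,
    [/\ measurable_fun setT K, (forall x, 0 <= K x)%E,
      (\int[borel_lebesgue R n]_x K x < +oo)%E &
      forall x, ((`|Psi i (tnth x i)| `^ q *
        \prod_(k < n) W k (tnth x k))%:E <= K x)%E].
Proof.
move=> q0 mW W0 iW mG G0 Goo GW i.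
pose h k := EFin \o W k.
have mh k : measurable_fun setT (h k) by apply/measurable_EFinP.
have h0 k t : (0 <= h k t)%E by rewrite /h /= lee_fin.
pose V x := (\prod_(k < n) h k (tnth x k))%E.
have VE x : V x = (\prod_(k < n) W k (tnth x k))%:E by rewrite -prodEFin.
have mV : measurable_fun setT V by exact: measurable_coord_prod.
have V0 x : (0 <= V x)%E by exact: prode_ge0.
have iV : (\int[borel_lebesgue R n]_x V x =
    \prod_(k < n) \int[lebesgue_measure]_t h k t)%E by exact: integral_coord_prod.
have Voo : (\int[borel_lebesgue R n]_x V x < +oo)%E.
  by under eq_integral do rewrite VE.
have [p0|p0] := eqVneq (\prod_(k < n) \int[lebesgue_measure]_t h k t)%E 0%E.
  (* [V] vanishes almost everywhere, and [+oo * 0 = 0]. *)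
  exists (fun x => +oo * V x)%E; split.
  - exact: measurable_funeM.
  - by move=> x; rewrite mule_ge0.
  - by rewrite ge0_integralZl// iV p0 mule0.
  - move=> x; rewrite EFinM -VE lee_wpmul2r// leey//.
have hoo k : (0 < \int[lebesgue_measure]_t h k t < +oo)%E.
  apply: (prode_lty_factor _ p0) => [j|]; last by rewrite -iV.
  exact: integral_ge0.
have [|H [mH H0 Hoo HW]] := @coordinate_majorant R q n W Psi 0 G q0 mW W0 hoo mG G0 Goo _ i.
  by move=> x; rewrite addr0.
pose g k := if k == i then H else h k.
have mg k : measurable_fun setT (g k) by rewrite /g; case: ifP.
have g0 k t : (0 <= g k t)%E by rewrite /g; case: ifP.
exists (fun x => \prod_(k < n) g k (tnth x k))%E; split.
- exact: measurable_coord_prod.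
- by move=> x; exact: prode_ge0.
- rewrite integral_coord_prod//.
  suff /andP[] : (0 <= \prod_(k < n) \int[lebesgue_measure]_t g k t < +oo)%E by [].
  elim/big_ind : _ => [|x y /andP[x0 xoo] /andP[y0 yoo]|k _].
  + by rewrite lee01 ltry.
  + by rewrite mule_ge0//= lte_mul_pinfty// ge0_fin_numE.
  + rewrite integral_ge0//= /g; case: ifP => // _.
    by case/andP: (hoo k).
- move=> x; rewrite (bigD1 i)//= mulrA EFinM [leRHS](bigD1 i)//= {1}/g eqxx.
  rewrite -prodEFin (eq_bigr (fun k => g k (tnth x k))); last first.
    by move=> k /negbTE ki; rewrite /g ki.
  by rewrite lee_wpmul2r// prode_ge0.
Qed.

(** * From one-variable functions and null sets to the box *)

Lemma lebesgue_line_ae_borel (R : realType) (D : set (measurableTypeR R))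
    (f : R -> R) : measurable D ->
  measurable_fun (D : set (lebesgue_line R)) (f : lebesgue_line R -> R) ->
  exists N : set (measurableTypeR R), [/\ measurable N,
    lebesgue_measure N = 0%E &
    measurable_fun (D `\` N) (f : measurableTypeR R -> R)].
Proof.
move=> mD mf.
have mcD : measurable (D : set (lebesgue_line R)).
  exact: sub_caratheodory.
apply: (@ae_borel_measurable_fun _ _ _ (@lebesgue_measure R) D f mD) => B mB.
(* [lebesgue_line] is built on the outer measure of [wlength], so the decomposition is read off from
   the completed algebra: Borel sets united with subsets of Borel null sets. *)
have : (completed_algebra_gen (@lebesgue_measure R)) (D `&` f @^-1` B).
  rewrite -g_sigma_completed_algebra_genE completed_caratheodory_measurable.
  exact: mf.
move=> [A mA [N' [N [mN N0 N'N]]] <-].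
by exists A, N; split => //; exact: setUS.
Qed.

(** Setting [f] to zero off [D] and on the exceptional null set makes it Borel on the whole line and
    keeps it below [f] at every point of [D]. Products of such functions then stay below [w]
    everywhere on the box, with no null set to track. *)
Lemma borel_minorant (R : realType) (D : set (measurableTypeR R))
    (f : R -> R) : measurable D ->
  measurable_fun (D : set (lebesgue_line R)) (f : lebesgue_line R -> R) ->
  (forall t, D t -> 0 <= f t) ->
  exists (W : measurableTypeR R -> R) (N : set (measurableTypeR R)),
    [/\ measurable_fun setT W, (forall t, 0 <= W t),
     (forall t, ~ D t -> W t = 0), (forall t, D t -> W t <= f t) &
     [/\ measurable N, lebesgue_measure N = 0%E &
       forall t, D t -> ~ N t -> W t = f t]].
Proof.
move=> mD mf f0; have [N [mN N0 mfN]] := lebesgue_line_ae_borel mD mf.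
have mDN := measurableD mD mN.
exists (f \_ (D `\` N)), N; split.
- exact/(measurable_restrictT _ mDN).
- by move=> t; rewrite patchE; case: ifPn => // /set_mem[Dt _]; exact: f0.
- by move=> t nDt; rewrite patchE memNset// => -[].
- by move=> t Dt; rewrite patchE; case: ifPn => // _; exact: f0.
- by split => // t Dt Nt; rewrite patchE mem_set.
Qed.

(** The set where coordinate [k] falls in [N] is a box with one null side; its measure is zero even
    though the other sides are infinite. *)
Lemma ae_coord (R : realType) (n : nat) (k : 'I_n)
    (N : set (measurableTypeR R)) : measurable N -> lebesgue_measure N = 0%E ->
  {ae lebesgue R n, forall x, ~ N (tnth x k)}.
Proof.
move=> mN N0.
pose A l : set (measurableTypeR R) := if l == k then N else setT.
have mA l : measurable (A l) by rewrite /A; case: ifP.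
exists [set x | forall l, A l (tnth x l)]; split.
- apply: caratheodory_borel.
  rewrite (_ : [set x | _] = \bigcap_(l in setT)
      ((fun x : n.-tuple (measurableTypeR R) => tnth x l) @^-1` A l)).
    apply: fin_bigcap_measurable => // l _; rewrite -[X in measurable X]setTI.
    exact: measurable_tnth.
  by apply/seteqP; split => [x h l _|x h l]; [exact: h|exact: (h l)].
- by rewrite lebesgue_box// (bigD1 k)//= /A eqxx N0 mul0e.
- move=> x /= /contrapT Nx l; rewrite /A; case: ifP => // /eqP ->.
  exact: Nx.
Qed.

Lemma measurable_box (R : realType) (n : nat) (I : 'I_n -> interval R) :
  measurable (box I : set (n.-tuple (measurableTypeR R))).
Proof.
rewrite (_ : box I = \bigcap_(l in setT)
    ((fun x : n.-tuple (measurableTypeR R) => tnth x l) @^-1` [set` I l])).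
  apply: fin_bigcap_measurable => // l _; rewrite -[X in measurable X]setTI.
  exact: measurable_tnth.
by apply/seteqP; split => [x h l _|x h l]; [exact: h|exact: (h l)].
Qed.

Lemma measurable_normr_powR d (T : measurableType d) (R : realType) (q : R)
    (D : set T) (f w : T -> R) :
  measurable_fun D f -> measurable_fun D w ->
  measurable_fun D (fun x => `|f x| `^ q * w x).
Proof.
move=> mf mw; apply: measurable_funM => //.
apply: (measurableT_comp (measurable_powR q)); exact: measurableT_comp.
Qed.

(** * Summation over the product densities and the Smirnov property *)

Theorem proposition2p6 (R : realType) (n : nat) (n_ge2 : (2 <= n)%N)
    (I : 'I_n -> interval R) (I_adm : forall i, admissible_itv (I i))
    (w : lebesgue_space R n -> R)
    (w_density : strictly_positive_density (box I) w)
    (d : nat) (d_ge1 : (1 <= d)%N)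
    (wf : 'I_d -> 'I_n -> lebesgue_line R -> R)
    (wf_meas : forall j i, measurable_fun ([set` I i] : set (lebesgue_line R)) (wf j i))
    (wf_ge0 : forall j i t, t \in I i -> 0 <= wf j i t)
    (w_eq : forall x, box I x ->
       w x = \sum_(j < d) \prod_(i < n) coord_fun i (wf j i) x) :
  forall q : R, 1 < q -> smirnov (box I) w q.
Proof.
move=> q q1 f Psi f_ae [mf f_int] Psi1 i.
have [mPsi _] := Psi1 i; split => //.
have q0 : 0 <= q by rewrite (le_trans _ (ltW q1)).
have n0 : n%:R != 0 :> R by rewrite pnatr_eq0 -lt0n (leq_trans _ n_ge2).
have [mw w_gt0 w_int] := w_density.
have w_ge0 x : box I x -> 0 <= w x by move=> /w_gt0/ltW.
have mbox := measurable_box I.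
have mcbox : measurable (box I) by exact: caratheodory_borel.
have mI l : measurable ([set` I l] : set (measurableTypeR R)).
  exact: measurable_itv.
have /choice[W' hW'] (jk : 'I_d * 'I_n) :=
  borel_minorant (mI jk.2) (wf_meas jk.1 jk.2) (fun t => wf_ge0 jk.1 jk.2 t).
have /choice[N' hN'] := hW'.
pose W j k := W' (j, k); pose N j k := N' (j, k).
have mW j k : measurable_fun setT (W j k) by have [] := hN' (j, k).
have W0 j k t : 0 <= W j k t by have [_ + _ _ _] := hN' (j, k); exact.
(* Vanishing off the box lets the bounds below hold on the whole space. *)
have W_out j x : ~ box I x -> \prod_(k < n) W j k (tnth x k) = 0.
  move=> /existsNP[k Ik]; rewrite (bigD1 k)//=.
  have [_ _ Wk0 _ _] := hN' (j, k).
  by rewrite [W j k _](Wk0 _ Ik) mul0r.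
have W_le j x : box I x -> \prod_(k < n) W j k (tnth x k) <= w x.
  move=> Ix; rewrite w_eq// (bigD1 j)//=; apply: ler_wpDr.
    apply: sumr_ge0 => l _; apply: prodr_ge0 => k _; apply: wf_ge0; exact: Ix.
  apply: ler_prod => k _; rewrite W0/=.
  by have [_ _ _ + _] := hN' (j, k); apply; exact: Ix.
(* This majorant of [w] serves to bound the integrals of the Borel products; with a trivial [P] no
   exceptional points are marked. *)
have [|||||Gw [mGw Gw0 Gwoo wGw _]] :=
    @borel_majorant _ _ _ (borel_lebesgue R n) (box I) w (fun=> True).
- exact: mbox.
- exact: mw.
- exact: w_ge0.
- by rewrite [ltLHS]w_int ltry.
- by exists set0; split => // x [].
have W_oo j : (\int[borel_lebesgue R n]_x
    (\prod_(k < n) W j k (tnth x k))%:E < +oo)%E.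
  apply: le_lt_trans Gwoo; apply: ge0_le_integral => //.
  - by move=> x _; rewrite lee_fin prodr_ge0.
  - under eq_fun do rewrite -prodEFin.
    apply: (measurable_coord_prod (h := fun k => EFin \o W j k)) => k.
    by apply/measurable_EFinP; exact: mW.
  - move=> x _; have [Ix|/W_out ->] := pselect (box I x); last exact: Gw0.
    by apply: le_trans (wGw _ Ix); rewrite lee_fin W_le.
(* The factor [n^q] turns the average into the sum. [G] is [+oo] wherever the almost everywhere
   identity for [f] fails. *)
have [||||G [mG G0 Goo gG Gae]] :=
    @borel_majorant _ _ _ (borel_lebesgue R n) (box I)
      (fun x => n%:R `^ q * (`|f x| `^ q * w x)) _ _ _ _ _ f_ae.
- exact: mbox.
- apply: measurable_funM; first exact: measurable_cst.
  exact: measurable_normr_powR.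
- by move=> x Ix; rewrite !mulr_ge0 ?powR_ge0// w_ge0.
- under eq_integral do rewrite EFinM.
  rewrite ge0_integralZl//.
  + by rewrite lte_mul_pinfty// lee_fin powR_ge0.
  + by apply/measurable_EFinP; exact: measurable_normr_powR.
  + by move=> x Ix; rewrite lee_fin mulr_ge0 ?powR_ge0// w_ge0.
have GW j x : ((`|\sum_(k < n) Psi k (tnth x k)| `^ q *
    \prod_(k < n) W j k (tnth x k))%:E <= G x)%E.
  have [Ix|/W_out ->] := pselect (box I x); last by rewrite mulr0.
  have [fx|/Gae ->] := pselect (box I x -> f x =
      n%:R^-1 * \sum_(i < n) coord_fun i (Psi i) x); last by rewrite leey.
  apply: le_trans (gG _ Ix); rewrite lee_fin mulrA -powRM//.
  rewrite -(ger0_norm (ler0n R n)) -normrM fx// mulVKf//.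
  by rewrite ler_wpM2l ?powR_ge0 ?W_le.
have /choice[K hK] j := term_majorant q0 (mW j) (W0 j) (W_oo j) mG G0 Goo (GW j) i.
have mK j : measurable_fun setT (K j) by have [] := hK j.
have K0 j x : (0 <= K j x)%E by have [_ + _ _] := hK j; exact.
have mcK j : measurable_fun setT (K j : lebesgue_space R n -> \bar R).
  by move=> _ A mA; rewrite setTI; apply: caratheodory_borel;
    rewrite -[X in measurable X]setTI; exact: mK.
have K_oo : (\int[borel_lebesgue R n]_x (\sum_(j < d) K j x) < +oo)%E.
  rewrite ge0_integral_sum//; apply: lte_sum_pinfty => j _.
  by have [] := hK j.
apply: le_lt_trans K_oo.
(* The sum of the [K j] is Borel, so its integral can be moved to the completed measure, in which
   the other integrand is measurable. *)
rewrite -(integral_completion (borel_lebesgue R n) measurableT); last 2 first.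
- exact: emeasurable_sum.
- by move=> x _; exact: sume_ge0.
apply: (@le_trans _ _ (\int[lebesgue R n]_(x in box I) (\sum_(j < d) K j x))%E).
  apply: ae_ge0_le_integral => //.
  - by move=> x Ix; rewrite lee_fin mulr_ge0 ?powR_ge0// w_ge0.
  - by apply/measurable_EFinP; exact: measurable_normr_powR.
  - by move=> x _; exact: sume_ge0.
  - by apply: emeasurable_sum => j; exact: measurable_funTS.
  (* Off finitely many null cylinders every [W j k] equals the original factor, so [w] is the sum of
     the Borel products and the bounds by the [K j] add up. *)
  have aeN : {ae lebesgue R n, forall x, forall j k, ~ N j k (tnth x k)}.
    apply: filter_forall => j; apply: filter_forall => k.
    by have [_ _ _ _ [mN N0 _]] := hN' (j, k); exact: ae_coord.
  have [A [mA A0 NA]] := aeN; exists A; split => //.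
  apply: subset_trans NA => x /=; apply: contra_not => Nx Ix.
  rewrite w_eq// mulr_sumr -sumEFin; apply: lee_sum => j _.
  rewrite (eq_bigr (fun k => W j k (tnth x k))) => [|k _].
    by have [_ _ _ +] := hK j; exact.
  by have [_ _ _ _ [_ _ WN]] := hN' (j, k); apply/esym/WN; [exact: Ix|exact: Nx].
apply: ge0_subset_integral => //.
- exact: emeasurable_sum.
- by move=> x _; exact: sume_ge0.
Qed.
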